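(* Let $(X,T)$ and $(Y,R)$ be two minimal Cantor systems. Then there exists a Poincaré section $C\subset Y$ of $(Y,R)$ such that $(C,R_C)$ is topologically conjugate to $(X,T)$.
   Context: A minimal Cantor system is a pair $(X,T)$, $X$ a Cantor set, $T$ a homeomorphism with all orbits dense. For a minimal Cantor system $(Y,R)$, a Poincaré section is a nonempty closed set $C\subset Y$ such that the first return map $R_C:C\to C$, $R_C(x)=R^{r_C(x)}(x)$ with $r_C(x)=\inf\{n>0:R^nx\in C\}$, is a well-defined homeomorphism of $C$. *)

(* Defs.v *)
From HB Require Import structures.
From mathcomp Require Import all_boot all_order all_algebra.
From mathcomp Require Import all_classical all_reals all_analysis.
Set Implicit Arguments. Unset Strict Implicit. Unset Printing Implicit Defensive.
Import Order.TTheory GRing.Theory Num.Theory.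
Local Open Scope classical_set_scope.

(* A Cantor set: a nonempty compact metrizable (here: metric, i.e. Hausdorff
   pseudometric) space which is perfect and zero-dimensional
   (Brouwer's characterization). *)
Definition cantor_set (R : realType) (X : pseudoMetricType R) : Prop :=
  [set: X] !=set0 /\ cantor_like X.

Definition is_homeo (X : topologicalType) (T Tinv : X -> X) : Prop :=
  [/\ cancel T Tinv, cancel Tinv T, continuous T & continuous Tinv].

Definition orbit (X : Type) (T Tinv : X -> X) (x : X) : set X :=
  [set y | exists n : nat, y = iter n T x \/ y = iter n Tinv x].

Definition minimal_cantor_system (R : realType) (X : pseudoMetricType R)
  (T : X -> X) : Prop :=
  cantor_set X /\
  exists Tinv : X -> X, is_homeo T Tinv /\
    forall x : X, closure (orbit T Tinv x) = [set: X].

(* first return time r_C(x) = inf {n > 0 | R^n x \in C}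
   (chosen as 0 when that set is empty; irrelevant for Poincaré sections) *)
Definition return_time (Y : Type) (R : Y -> Y) (C : set Y) (x : Y) : nat :=
  xget 0%N [set n : nat | (0 < n)%N /\ C (iter n R x) /\
                           forall m : nat, (0 < m < n)%N -> ~ C (iter m R x)].

Definition first_return (Y : Type) (R : Y -> Y) (C : set Y) (x : Y) : Y :=
  iter (return_time R C x) R x.

Definition poincare_section (Y : topologicalType) (R : Y -> Y) (C : set Y)
  : Prop :=
  [/\ C !=set0, closed C,
      (forall x, C x -> exists n : nat, (0 < n)%N /\ C (iter n R x)),
      set_bij C C (first_return R C) &
      {within C, continuous (first_return R C)}] /\
      exists g : Y -> Y, [/\ {in C, cancel (first_return R C) g},
                             {in C, cancel g (first_return R C)},
                             set_fun C C g & {within C, continuous g}].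

Definition conjugate_to_subsystem (X Y : topologicalType) (T : X -> X)
  (C : set Y) (S : Y -> Y) : Prop :=
  exists (phi : X -> Y) (psi : Y -> X),
    [/\ (forall x, C (phi x)), cancel phi psi, {in C, cancel psi phi},
        continuous phi & {within C, continuous psi}] /\
    (forall x, phi (T x) = S (phi x)).

(* Main.v *)
Require Import Defs.
From HB Require Import structures.
From mathcomp Require Import all_boot all_order all_algebra.
From mathcomp Require Import all_classical all_reals all_analysis.
From mathcomp Require Import zify.
Set Implicit Arguments. Unset Strict Implicit. Unset Printing Implicit Defensive.
Import Order.TTheory GRing.Theory Num.Theory.

(* Both spaces are copies of [nat -> bool].  Fix [xs] in [X] and [z] in [Y].  The
   conjugacy [phi] is a limit of locally constant maps [x |-> R^(p_k x) z] with
   integer times [p_k x] such that [p_k xs = 0] and [p_k (T xs) = 1].  Let [U_k] be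
   the [k]-cylinder around [xs] and cut [X] into Kakutani-Rokhlin towers with tops
   in [U_k].  Inside a tower the times increase, the increments never change again
   at later stages, and distinct towers occupy disjoint intervals of times.
   To pass to the next stage, each longer tower is a concatenation of old ones, and
   the old blocks are shifted by widely spaced times [c] with [R^c z] close to [z]
   (these exist by minimality).  Since no assigned time lies strictly between
   [p_k x] and [p_k (T x)], and the points [R^q z] are pairwise distinct, [phi] is
   injective and [p_k (T x) - p_k x], for any [k] with [x] outside [U_k], is the
   first return time of [phi x] to the range of [phi].  The return time is
   locally bounded away from [xs], and at [xs] itself it equals [1]. *)

(** * Finite agreement in the Cantor space *)

Definition agree (n : nat) (x y : nat -> bool) : bool :=
  all (fun i => x i == y i) (iota 0 n).

Lemma agreeP n x y : reflect (forall i, i < n -> x i = y i) (agree n x y).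
Proof.
apply: (iffP allP) => [h i ilt|h i]; first by apply/eqP/h; rewrite mem_iota.
by rewrite mem_iota => /= ilt; apply/eqP/h.
Qed.

Lemma agree_refl n x : agree n x x.
Proof. exact/agreeP. Qed.

Lemma agree_sym n x y : agree n x y = agree n y x.
Proof. by apply/agreeP/agreeP => h i /h. Qed.

Lemma agree_trans n y x z : agree n x y -> agree n y z -> agree n x z.
Proof. by move=> /agreeP h1 /agreeP h2; apply/agreeP => i ilt; rewrite h1 ?h2. Qed.

Lemma agreeW m n x y : m <= n -> agree n x y -> agree m x y.
Proof. by move=> mn /agreeP h; apply/agreeP => i im; apply: h; exact: leq_trans mn. Qed.

Lemma agree_eq x y : (forall n, agree n x y) -> x = y.
Proof. by move=> h; apply/funext => i; have /agreeP := h i.+1; apply. Qed.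

Lemma agree_mkseq n x y : agree n x y = (mkseq x n == mkseq y n).
Proof.
apply/agreeP/eqP => [h|e i ilt].
  by apply/eq_in_map => i; rewrite mem_iota => /h.
by have := congr1 (fun s => nth false s i) e; rewrite !nth_mkseq.
Qed.

Lemma neq_disagree x y : x <> y -> exists n, ~~ agree n x y.
Proof.
move=> xy; apply/not_existsP => h; apply: xy; apply: agree_eq => n.
by apply/negPn/negP; exact: h.
Qed.

(** Continuity phrased on finite prefixes; by compactness it amounts to continuity on
    [cantor_space]. *)
Definition unif_cont (f : (nat -> bool) -> nat -> bool) :=
  forall n, exists m, forall x y, agree m x y -> agree n (f x) (f y).

Definition loc_const (B : Type) (f : (nat -> bool) -> B) :=
  exists n, forall x y, agree n x y -> f x = f y.

Lemma unif_cont_iter f k : unif_cont f -> unif_cont (iter k f).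
Proof.
move=> fc; elim: k => [|k IH] n; first by exists n.
by have [m hm] := fc n; have [l hl] := IH m; exists l => x y /hl/hm.
Qed.

Lemma unif_cont_upto (f : nat -> (nat -> bool) -> nat -> bool) H n :
  (forall k, unif_cont (f k)) ->
  exists m, forall x y, agree m x y -> forall k, k <= H -> agree n (f k x) (f k y).
Proof.
move=> fc; elim: H => [|H [m hm]].
  by have [m hm] := fc 0 n; exists m => x y /hm ? k; rewrite leqn0 => /eqP->.
have [l hl] := fc H.+1 n; exists (maxn m l) => x y xy k.
rewrite leq_eqVlt => /predU1P[->|]; first exact/hl/(agreeW _ xy)/leq_maxr.
by apply: hm; apply: agreeW xy; exact: leq_maxl.
Qed.

Lemma loc_const_bounded (p : (nat -> bool) -> int) : loc_const p ->
  exists M : nat, forall x, `|p x|%N <= M.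
Proof.
(* [e t] pads a prefix of length [n] with [false]; [p] takes all its values on these finitely many
   points. *)
move=> [n pn]; pose e (t : {ffun 'I_n -> bool}) (i : nat) :=
  if insub i is Some j then t j else false.
exists (\max_t `|p (e t)|%N) => x.
rewrite (pn x (e [ffun i : 'I_n => x i])); last first.
  by apply/agreeP => i ilt; rewrite /e insubT ffunE.
exact: (@leq_bigmax _ (fun t => `|p (e t)|%N)). 
Qed.

Section IntegerIterates.
Context (X : Type) (T T' : X -> X).
Hypotheses (TK : cancel T T') (T'K : cancel T' T).

Definition zpow (k : int) : X -> X :=
  match k with Posz n => iter n T | Negz n => iter n.+1 T' end.

Lemma zpowS k x : zpow (k + 1) x = T (zpow k x).
Proof.
case: k => [n|[|n]]; first by rewrite -PoszD addn1.
  by rewrite /= T'K.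
by rewrite (_ : (Negz n.+1 + 1)%R = Negz n) /= ?T'K //; lia.
Qed.

Lemma zpowV k x : zpow (k - 1) x = T' (zpow k x).
Proof. by rewrite -[k in RHS](subrK 1%R) zpowS TK. Qed.

Lemma zpowD k l x : zpow (k + l) x = zpow k (zpow l x).
Proof.
elim/int_rect: k => [|n IH|n IH]; first by rewrite add0r.
  by rewrite -addn1 PoszD addrAC !zpowS IH.
by rewrite -addn1 PoszD opprD addrAC !zpowV IH.
Qed.

End IntegerIterates.

(** * Minimal systems on the Cantor space *)

(** [cs_dense] is minimality with a visit time bounded uniformly in the starting point, as
    compactness allows. *)
Record cantor_system (T T' : (nat -> bool) -> nat -> bool) : Prop :=
  CantorSystem {
    csK : cancel T T';
    csKV : cancel T' T;
    cs_cont : unif_cont T;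
    cs_contV : unif_cont T';
    cs_dense : forall n x, exists N : nat, forall y, exists k : int,
      `|k|%N <= N /\ agree n x (zpow T T' k y) }.

Section CantorSystem.
Context (T T' : (nat -> bool) -> nat -> bool) (sT : cantor_system T T').

Local Notation zT := (zpow T T').

Let zTD k l x : zT (k + l) x = zT k (zT l x).
Proof. by apply: zpowD; [exact: (csK sT)|exact: (csKV sT)]. Qed.

(** Starting from [T^-(N+1) y] makes every visit time in [[-N, N]] strictly negative relative to
    [y]. *)
Lemma backward_syndetic n x : exists H : nat, forall y, exists j,
  j <= H /\ agree n x (iter j.+1 T' y).
Proof.
have [N hN] := cs_dense sT n x; exists (N + N) => y.
have [k [kN xk]] := hN (zT (- (N.+1%:Z)) y); exists (`|(N%:Z - k)%R|)%N; split; first by lia.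
move: xk; rewrite -zTD.
have -> : (k - N.+1%:Z)%R = Negz `|(N%:Z - k)%R|%N by rewrite NegzE; lia.
by [].
Qed.

Lemma recurrent n x (N : nat) : exists c : int,
  (N%:Z < c)%R /\ agree n x (zT c x).
Proof.
have [M hM] := cs_dense sT n x.
have [k [kN xk]] := hM (zT (N + M).+1%:Z x); exists (k + (N + M).+1%:Z)%R.
by rewrite zTD; split => //; lia.
Qed.

Lemma recurrentV n x (N : nat) : exists c : int,
  (c < - N%:Z)%R /\ agree n x (zT c x).
Proof.
have [M hM] := cs_dense sT n x.
have [k [kN xk]] := hM (zT (- (N + M).+1%:Z) x); exists (k - (N + M).+1%:Z)%R.
by rewrite zTD; split => //; lia.
Qed.

Lemma aperiodic m x : iter m.+1 T x <> x.
Proof.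
move=> per.
have per_mod k : exists2 j, j <= m & zT k x = iter j T x.
  elim/int_rect: k => [|n [j jm IH]|n [j jm IH]]; first by exists 0.
    rewrite -addn1 PoszD (zpowS (csKV sT)) IH.
    have [->|jm'] := eqVneq j m; first by exists 0.
    by exists j.+1 => //; lia.
  rewrite -addn1 PoszD opprD (zpowV (csK sT) (csKV sT)).
  rewrite IH; case: j jm {IH} => [_|j jm].
    by exists m => //=; rewrite -{1}per /= (csK sT).
  by exists j; [lia|rewrite /= (csK sT)].
(* [y] disagrees with [iter i T x] at place [i], so no orbit point is close to it. *)
pose y i := ~~ iter i T x i.
have [N /(_ x)[k [_]]] := cs_dense sT m.+1 y.
have [j jm ->] := per_mod k; move=> /agreeP/(_ j).
by rewrite ltnS jm /y => /(_ isT); case: (iter j T x j).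
Qed.

Lemma zpow_inj x : injective (zT^~ x).
Proof.
have h (k l : int) : zT k x = zT l x -> ~ (k < l)%R.
  move=> kl lt; apply: (@aperiodic `|(l - k)%R|.-1 (zT k x)).
  have -> : iter `|(l - k)%R|.-1.+1 T (zT k x) = zT (l - k) (zT k x).
    by rewrite (_ : (l - k)%R = Posz (`|(l - k)%R|.-1.+1)) //; lia.
  by rewrite -zTD subrK.
by move=> k l kl; have := h _ _ kl; have := h _ _ (esym kl); lia.
Qed.

End CantorSystem.

(** Elements of [G] are picked successively upwards and downwards from 0. The gap [L] will absorb
    the oscillation of the old times. *)
Lemma sparse_sequence (G : int -> Prop) (L : nat) :
  G 0%R ->
  (forall N : nat, exists c : int, (N%:Z < c)%R /\ G c) ->
  (forall N : nat, exists c : int, (c < - N%:Z)%R /\ G c) ->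
  exists g : int -> int, [/\ g 0%R = 0%R, forall n, G (g n) &
    forall m n : int, (m < n)%R -> (g m + L%:Z < g n)%R].
Proof.
move=> G0 Gp Gn.
have /choice[f fP] (c : int) : exists d : int, (c + L%:Z < d)%R /\ G d.
  by have [d [ltd Gd]] := Gp (`|c|%N + L); exists d; split => //; lia.
have /choice[h hP] (c : int) : exists d : int, (d + L%:Z < c)%R /\ G d.
  by have [d [ltd Gd]] := Gn (`|c|%N + L); exists d; split => //; lia.
pose g (k : int) := match k with Posz n => iter n f 0 | Negz n => iter n.+1 h 0 end.
have gS k : (g k + L%:Z < g (k + 1))%R.
  case: k => [n|[|n]]; first by rewrite -PoszD addn1; apply: (fP _).1.
    exact: (hP _).1.
  by rewrite (_ : (Negz n.+1 + 1)%R = Negz n); [exact: (hP _).1|lia].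
exists g; split => //; first by case=> [[|n]|n] //; [apply: (fP _).2|apply: (hP _).2].
have gD m (n : nat) : (g m + L%:Z < g (m + n.+1%:Z))%R.
  elim: n => [|n IH]; first exact: gS.
  have := gS (m + n.+1%:Z)%R; rewrite -addrA -PoszD addn1 => gSn.
  by apply: lt_trans gSn; apply: lt_le_trans IH _; rewrite lerDl; lia.
move=> m n mn; have := gD m `|(n - m)%R|.-1.
by rewrite (_ : (m + _)%R = n); lia.
Qed.

Lemma zpow_upto T T' x M n : cantor_system T T' ->
  exists D, forall y, agree D x y -> forall m : int, `|m|%N <= M ->
    agree n (zpow T T' m x) (zpow T T' m y).
Proof.
move=> sT.
have [D hD] := @unif_cont_upto (fun k => iter k T) M n
  (fun k => unif_cont_iter _ (cs_cont sT)).
have [E hE] := @unif_cont_upto (fun k => iter k T') M n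
  (fun k => unif_cont_iter _ (cs_contV sT)).
exists (maxn D E) => y xy [m|m] mM.
  by apply: hD => //; apply: agreeW xy; exact: leq_maxl.
by apply: hE; [apply: agreeW xy; exact: leq_maxr|rewrite NegzE abszN in mM].
Qed.

(** * Kakutani-Rokhlin towers *)

(* [a x] is the height of [x] in its tower over the base [T U], where [U] is the
   [u]-cylinder around [xs], so that [U] is the set of tower tops; [lam x] names
   the tower of [x].  The values of [q] are then ordered lexicographically by
   [(lam, a)]. *)
Section Towers.
Context (T T' : (nat -> bool) -> nat -> bool) (sT : cantor_system T T').
Context (xs : nat -> bool) (u : nat).

(** [a x] is the least [j] such that [T^-(j+1) x] lies in the cylinder. Backward syndeticity bounds
    it, so finitely many iterates decide it, whence local constancy. *)
Lemma tower_height : exists a : (nat -> bool) -> nat,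
  [/\ loc_const a, exists H, forall x, a x <= H &
      forall x, a (T x) = if agree u xs x then 0 else (a x).+1].
Proof.
have [H hH] := backward_syndetic sT u xs.
have ex x : exists j, agree u xs (iter j.+1 T' x).
  by have [j [_ ?]] := hH x; exists j.
have TK := csK sT.
pose a x := ex_minn (ex x).
have aP x : agree u xs (iter (a x).+1 T' x) by rewrite /a; case: ex_minnP.
have amin x j : agree u xs (iter j.+1 T' x) -> a x <= j.
  by rewrite /a; case: ex_minnP => m _ h /h.
have aH x : a x <= H.
  by have [j [jH /amin]] := hH x; move=> /leq_trans; apply.
exists a; split; last 1 first.
- move=> x; case: ifPn => [Ux|Ux].
    by apply/eqP; rewrite -leqn0; apply: amin; rewrite /= TK.
  apply/eqP; rewrite eqn_leq; apply/andP; split.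
    by apply: amin; rewrite iterSr TK.
  have := aP (T x); rewrite iterSr TK; case: (a (T x)) => [/=|m /amin//].
  by rewrite (negPf Ux).
- have [m hm] := @unif_cont_upto (fun k => iter k.+1 T') H u
    (fun k => unif_cont_iter _ (cs_contV sT)).
  exists m => x y xy.
  apply/eqP; rewrite eqn_leq; apply/andP; split; apply: amin.
    apply: agree_trans (aP y) _; rewrite agree_sym.
    by apply: (hm x y).
  exact: agree_trans (aP x) (hm _ _ xy _ (aH x)).
- by exists H.
Qed.

Context (a : (nat -> bool) -> nat) (lam q : (nat -> bool) -> int).
Hypothesis aT : forall x, a (T x) = if agree u xs x then 0 else (a x).+1.
Hypothesis lamT : forall x, ~~ agree u xs x -> lam (T x) = lam x.
Hypothesis qT : forall x, ~~ agree u xs x -> (q x < q (T x))%R.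
Hypothesis same_level : forall x w, lam x = lam w -> a x = a w -> q x = q w.

Lemma tower_pred n x : a x = n.+1 ->
  [/\ ~~ agree u xs (T' x), a (T' x) = n & lam (T' x) = lam x].
Proof.
rewrite -{1}[x](csKV sT) aT; case: ifPn => // nU [ax].
by split=> //; rewrite -lamT // (csKV sT).
Qed.

(** Descending from [w] one level at a time, [q] drops strictly until the level of [x], where
    [same_level] applies. *)
Lemma tower_mono x w : lam x = lam w -> a x < a w -> (q x < q w)%R.
Proof.
have [n] := ubnP (a w); elim: n w => // n IH w; rewrite ltnS => awn lxw axw.
case aw: (a w) axw awn => [//|m] axw mn.
have [nU am lm] := tower_pred aw.
have := qT nU; rewrite (csKV sT); apply: le_lt_trans.
move: axw; rewrite ltnS leq_eqVlt => /predU1P[axm|axm].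
  by rewrite (@same_level x (T' w)) // ?lm // axm am.
by apply/ltW/IH; rewrite ?am ?lm.
Qed.

Lemma tower_level x j : j < a x ->
  exists w, [/\ ~~ agree u xs w, a w = j & lam w = lam x].
Proof.
have [n] := ubnP (a x); elim: n x => // n IH x; rewrite ltnS.
case ax: (a x) => [//|m] mn.
have [nU am lm] := tower_pred ax.
rewrite ltnS leq_eqVlt => /predU1P[->|jm]; first by exists (T' x).
by have [||w [wU aw lw]] := IH (T' x); rewrite ?am //; exists w; rewrite lw lm.
Qed.

Hypothesis label_order : forall x w, (lam x < lam w)%R -> (q x < q w)%R.

Lemma tower_sep x w : q x = q w -> lam x = lam w /\ a x = a w.
Proof.
move=> qxw; have lxw : lam x = lam w.
  by case: (ltgtP (lam x) (lam w)) => // /label_order; rewrite qxw ltxx.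
split=> //; case: (ltngtP (a x) (a w)) => // h.
  by have := tower_mono lxw h; rewrite qxw ltxx.
by have := tower_mono (esym lxw) h; rewrite qxw ltxx.
Qed.

(** [T x] is the immediate lexicographic successor of [x]: same label, one level up. *)
Lemma tower_gap x w : ~~ agree u xs x -> (q w <= q x)%R \/ (q (T x) <= q w)%R.
Proof.
move=> nU; have lT := lamT nU.
case: (ltgtP (lam w) (lam x)) => [/label_order/ltW|h|lwx]; first by left.
  by right; apply/ltW/label_order; rewrite lT.
case: (ltngtP (a w) (a x)) => h.
- by left; apply/ltW/tower_mono.
- have aTx : a (T x) = (a x).+1 by rewrite aT (negPf nU).
  right; move: h; rewrite -aTx leq_eqVlt => /predU1P[h|h].
    by rewrite (same_level _ h) // lT.
  by apply/ltW/tower_mono; rewrite ?lT.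
- by left; rewrite (same_level lwx h).
Qed.

End Towers.

(** * Extending an assignment of times *)

Section Extension.
Context (T T' : (nat -> bool) -> nat -> bool) (sT : cantor_system T T').
Context (R R' : (nat -> bool) -> nat -> bool) (sR : cantor_system R R').
Context (xs z : nat -> bool).

(* [p] assigns a time to each point of [X]: the embedding is approximated by
   [x |-> R^(p x) z].  Over the complement of the [u]-cylinder around [xs] the
   increment [p (T x) - p x] is final, and will be the first return time. *)
Record stage (u : nat) (p : (nat -> bool) -> int) : Prop := Stage {
  stage_lc : loc_const p;
  stage_top : p xs = 0%R;
  stage_bot : p (T xs) = 1%R;
  stage_lt : forall x, ~~ agree u xs x -> (p x < p (T x))%R;
  stage_gap : forall x w, ~~ agree u xs x -> (p w <= p x)%R \/ (p (T x) <= p w)%R;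
  stage_sep : forall x w, p x = p w -> agree u x w }.

(** The 0-cylinder is everything, so besides local constancy only the values at [xs] and [T xs] are
    constrained; the indicator of the complement of a small cylinder around [xs] provides them. *)
Lemma stage0 : exists p, stage 0 p.
Proof.
have [n nT] : exists n, ~~ agree n xs (T xs).
  by apply: neq_disagree => e; apply: (@aperiodic _ _ sT 0 xs).
exists (fun x => Posz (~~ agree n xs x)); split => //; last 2 first.
- by rewrite agree_refl.
- by rewrite nT.
exists n => x y xy; congr (Posz (nat_of_bool (~~ _))).
by apply/idP/idP => h; apply: agree_trans h _; rewrite // agree_sym.
Qed.

(* The new times are [p + g (theta x)], where [R^(g n) z] is so close to [z] that
   the approximate embedding hardly moves, and [theta] is constant along the
   steps that are already final, so that their increments are kept. *)
Lemma stage_extend u p (eta : nat) : stage u p ->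
  exists p', [/\ stage u.+1 p',
    forall x, ~~ agree u xs x -> (p' (T x) - p' x = p (T x) - p x)%R &
    forall x, agree eta (zpow R R' (p' x) z) (zpow R R' (p x) z)].
Proof.
move=> st; have [TK T'K] := (csK sT, csKV sT).
have [M pM] := loc_const_bounded (stage_lc st).
have [E zE] := @zpow_upto R R' z M eta sR.
(* Since [|p| <= M], a spacing above [2M] makes the order of the [g]-values prevail over that of
   [p]. *)
have [g [g0 gE gap]] := @sparse_sequence
  (fun c => agree E z (zpow R R' c z)) (M + M) (agree_refl _ _)
  (recurrent sR E z) (recurrentV sR E z).
have [a [alc [H aH] aT]] := tower_height sT xs u.+1.
have UU x : ~~ agree u xs x -> ~~ agree u.+1 xs x.
  by apply: contra; apply: agreeW.
pose b x := iter (a x) T' x.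
have iterK k : cancel (iter k T') (iter k T).
  by elim: k => // k IH x; rewrite iterSr /= T'K.
have bE x : iter (a x) T (b x) = x by rewrite iterK.
have bT x : b (T x) = if agree u.+1 xs x then T x else b x.
  by rewrite /b aT; case: ifP => // _; rewrite iterSr TK.
(* number of visits to the [u]-cylinder strictly below [x] in its tower *)
pose v x : nat := \sum_(j < a x) agree u xs (iter j T (b x)).
have vT x : ~~ agree u.+1 xs x -> v (T x) = v x + agree u xs x.
  by move=> nU; rewrite /v bT aT (negPf nU) big_ord_recr /= bE.
have vH x : v x <= H.
  apply: leq_trans (aH x); rewrite /v -[leqRHS]card_ord -sum1_card.
  by apply: leq_sum => j _; case: (agree _ _ _).
have [np plc] := stage_lc st.
(* Bases agreeing to depth [D1] force agreement at every level up to [H], deep enough to determine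
   [p] and the [u.+1]-cylinder. *)
have [D1 hD1] := @unif_cont_upto (fun k => iter k T) H (maxn u.+1 np)
  (fun k => unif_cont_iter _ (cs_cont sT)).
have bxs : T xs <> b xs.
  move=> e; apply: (@aperiodic _ _ sT (a xs) (T xs)).
  by rewrite {1}e iterS bE.
have [D2 hD2] := neq_disagree bxs.
pose D := maxn D1 D2.
have sepD : ~~ agree D (b xs) (T xs).
  by rewrite agree_sym; apply: contra hD2; apply: agreeW; exact: leq_maxr.
(* [T xs] must get time [1] and [xs] time [0] although the first is at the bottom
   of its tower and the second at the top.  Hence their towers, labelled [0] and
   [-1], have to be distinct; the former starts at time [1] and the latter, whose
   times are counted backwards, ends at time [0]. *)
pose lam x : int := if agree D (b x) (T xs) then 0%R else
  if agree D (b x) (b xs) then (-1)%R else Posz (pickle (mkseq (b x) D)).+1.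
have lam_agree x w : lam x = lam w -> agree D (b x) (b w).
  rewrite /lam; case: ifP => [x1|_].
    case: ifP => [w1 _|_]; last by case: ifP.
    by apply: agree_trans x1 _; rewrite agree_sym.
  case: ifP => [x1|_].
    case: ifP => // _; case: ifP => // w1 _.
    by apply: agree_trans x1 _; rewrite agree_sym.
  case: ifP => // _; case: ifP => // _ [] /(pcan_inj pickleK).
  by rewrite agree_mkseq => ->.
have lam_ge x : (-1 <= lam x)%R.
  by rewrite /lam; case: ifP => // _; case: ifP.
have lam_xs : lam xs = (-1)%R by rewrite /lam (negPf sepD) agree_refl.
have lam_Txs : lam (T xs) = 0%R by rewrite /lam bT !agree_refl.
have lamT x : ~~ agree u.+1 xs x -> lam (T x) = lam x.
  by move=> nU; rewrite /lam bT (negPf nU).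
have same x w : lam x = lam w -> a x = a w -> agree (maxn u.+1 np) x w.
  move=> /lam_agree h axw; rewrite -(bE x) -(bE w) -axw.
  by apply: hD1 => //; apply: agreeW h; exact: leq_maxl.
have same_v x w : lam x = lam w -> a x = a w -> v x = v w.
  move=> /lam_agree h axw; rewrite /v -axw; apply: eq_bigr => j _; congr nat_of_bool.
  have : agree u (iter j T (b x)) (iter j T (b w)).
    apply: (@agreeW _ (maxn u.+1 np)); first by rewrite leq_max leqnSn.
    apply: hD1; first by apply: agreeW h; exact: leq_maxl.
    exact/(leq_trans _ (aH x))/ltnW.
  move=> bxw; apply/idP/idP => h'; first exact: agree_trans bxw.
  by apply: agree_trans h' _; rewrite agree_sym.
(* Each nonnegative label owns a block of [H.+1] indices, enough as [v x <= H]. The tower of [xs] is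
   counted so as to end at index 0, where the tower of [T xs] also starts; [q_neg] and [q_pos]
   separate these two. *)
pose theta x : int := ((if lam x == -1 then - (v xs)%:Z else H.+1%:Z * lam x) + (v x)%:Z)%R.
pose q x : int := (p x + g (theta x))%R.
have thetaT x : ~~ agree u.+1 xs x -> theta (T x) = (theta x + Posz (agree u xs x))%R.
  by move=> nU; rewrite /theta lamT // vT // PoszD addrA.
have g_lt x w : (theta x < theta w)%R -> (q x < q w)%R.
  by move=> /gap; rewrite /q; have := pM x; have := pM w; lia.
have qT x : ~~ agree u.+1 xs x -> (q x < q (T x))%R.
  move=> nU; have := thetaT _ nU; case: (boolP (agree u xs x)) => [Ux e|/(stage_lt st) pT].
    by apply: g_lt; rewrite e ltrDl.
  by rewrite /q addr0 => ->; rewrite ltrD2r.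
have same_q x w : lam x = lam w -> a x = a w -> q x = q w.
  move=> l1 a1; rewrite /q /theta l1 (same_v _ _ l1 a1); congr (_ + _)%R.
  by apply: plc; apply: agreeW (same _ _ l1 a1); exact: leq_maxr.
have mono x w := @tower_mono _ _ sT xs u.+1 a lam q aT lamT qT same_q x w.
have q_xs : q xs = 0%R by rewrite /q /theta lam_xs eqxx addNr g0 (stage_top st).
have q_Txs : q (T xs) = 1%R.
  rewrite /q /theta lam_Txs /= mulr0 add0r /v aT agree_refl big_ord0 g0.
  by rewrite (stage_bot st).
have q_neg x : lam x = (-1)%R -> (q x <= 0)%R.
  move=> lx; rewrite -q_xs; have lxx : lam x = lam xs by rewrite lx.
  case: (ltngtP (a x) (a xs)) => h; first exact/ltW/mono.
    (* A point above the level of [xs] would have below it a [w] at that level outside the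
       [u.+1]-cylinder, although [same] makes [w] agree with [xs] to that depth. *)
    have [w [nU aw lw]] := tower_level sT aT lamT h.
    have := same w xs; rewrite lw lxx => /(_ erefl aw) /(agreeW (leq_maxl _ _)).
    by rewrite agree_sym (negPf nU).
  by rewrite (same_q _ _ lxx h).
have q_pos x : (0 <= lam x)%R -> (1 <= q x)%R.
  have aTxs : a (T xs) = 0 by rewrite aT agree_refl.
  rewrite -q_Txs le_eqVlt => /predU1P[l0|l0].
    have lx : lam (T xs) = lam x by rewrite lam_Txs.
    case: (posnP (a x)) => ax; first by rewrite (same_q _ _ lx) // ax.
    by apply/ltW/mono; rewrite ?aTxs.
  apply/ltW/g_lt; rewrite /theta lam_Txs /v aTxs big_ord0 /= mulr0 addr0.
  by rewrite ifF; nia.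
have lam_lt x w : (lam x < lam w)%R -> (q x < q w)%R.
  (* Label [-1] gives times at most 0 and the others at least 1; among the others the index blocks
     are disjoint. *)
  move=> lt; have [lx|nlx] := eqVneq (lam x) (-1)%R.
    by apply: le_lt_trans (q_neg _ lx) _; apply: lt_le_trans (q_pos w _); lia.
  apply: g_lt; rewrite /theta (negPf nlx) ifF; last by have := lam_ge x; lia.
  have := vH x; have := lam_ge x; nia.
exists q; split; last 2 first.
- move=> x nU; rewrite /q thetaT ?UU // (negPf nU) addr0; lia.
(* [R^(p x)] with [|p x| <= M] sends the [E]-close points [z] and [R^(g (theta x)) z] to [eta]-close
   ones. *)
- move=> x; rewrite /q addrC; have TD := zpowD (csK sR) (csKV sR).
  by rewrite agree_sym addrC !TD; apply: zE (pM x); exact: gE.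
split => //.
- have [m am] := alc.
  have [l hl] := @unif_cont_upto (fun k => iter k T') H D
    (fun k => unif_cont_iter _ (cs_contV sT)).
  exists (maxn m l) => x y xy.
  have axy : a x = a y by apply: am; apply: agreeW xy; exact: leq_maxl.
  apply: (same_q _ _ _ axy); rewrite /lam.
  suff Dt t : agree D (b x) t = agree D (b y) t.
    by rewrite !Dt; congr (if _ then _ else if _ then _ else Posz (pickle _).+1);
      apply/eqP; rewrite -agree_mkseq Dt agree_refl.
  have bxy : agree D (b x) (b y).
    by rewrite /b -axy; apply: hl => //; apply: agreeW xy; exact: leq_maxr.
  apply/idP/idP; apply: agree_trans => //.
  by rewrite agree_sym.
- by move=> x w; exact: (tower_gap sT aT lamT qT same_q lam_lt).
- move=> x w /(tower_sep sT aT lamT qT same_q lam_lt)[lxw axw].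
  by apply: agreeW (same _ _ lxw axw); exact: leq_maxl.
Qed.

End Extension.

(** * The limit embedding *)

(** Times in [[-N, N]] form finitely many pairs, and [zpow_inj] gives each unequal pair a depth of
    disagreement. *)
Lemma orbit_separated R R' z N : cantor_system R R' ->
  exists n, forall k l : int, `|k|%N <= N -> `|l|%N <= N ->
    agree n (zpow R R' k z) (zpow R R' l z) -> k = l.
Proof.
move=> sR.
have /choice[f fP] (kl : int * int) : exists n,
    agree n (zpow R R' kl.1 z) (zpow R R' kl.2 z) -> kl.1 = kl.2.
  have [->|ne] := eqVneq kl.1 kl.2; first by exists 0.
  have [n hn] : exists n, ~~ agree n (zpow R R' kl.1 z) (zpow R R' kl.2 z).
    by apply: neq_disagree => /(zpow_inj sR)/eqP; rewrite (negPf ne).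
  by exists n => h; rewrite h in hn.
pose c (i : 'I_(N + N).+1) : int := (i%:Z - N%:Z)%R.
have cP (k : int) : `|k|%N <= N -> exists i, k = c i.
  move=> kN; have lt : `|(k + N%:Z)%R|%N < (N + N).+1 by lia.
  by exists (Ordinal lt); rewrite /c /=; lia.
exists (\max_(ij : 'I_(N + N).+1 * 'I_(N + N).+1) f (c ij.1, c ij.2)) => k l.
move=> /cP[i ->] /cP[j ->] h; apply: (fP (c i, c j)); apply: agreeW h.
exact: (@leq_bigmax _ (fun ij : 'I_(N + N).+1 * 'I_(N + N).+1 => f (c ij.1, c ij.2)) (i, j)).
Qed.

Section Limit.
Context (T T' : (nat -> bool) -> nat -> bool) (sT : cantor_system T T').
Context (R R' : (nat -> bool) -> nat -> bool) (sR : cantor_system R R').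
Context (xs z : nat -> bool).

Local Notation zR k := (zpow R R' k z).
Local Notation stage := (stage T xs).

(* The case [m = 0] gives injectivity, the others exclude early returns. *)
Definition separates (p : (nat -> bool) -> int) (eta : nat) :=
  forall (x w y y' : nat -> bool) (m : nat), m <= `|(p (T x) - p x)%R|%N ->
    agree eta y (zR (p x)) -> agree eta y' (zR (p w)) ->
    iter m R y = y' -> (p x + m%:Z)%R = p w.

Lemma separates_ex p N : loc_const p -> exists2 eta, N < eta & separates p eta.
Proof.
move=> /loc_const_bounded[M pM].
(* The times compared are [p w] and [p x + m] with [m <= 2M], so all lie within [3M]. *)
have [n nP] := @orbit_separated R R' z (M + M + M) sR.
have [l lP] := @unif_cont_upto (fun k => iter k R) (M + M) n
  (fun k => unif_cont_iter _ (cs_cont sR)).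
exists (maxn N.+1 (maxn n l)) => [|x w y y' m mp]; first by rewrite leq_max leqnn.
move=> /(agreeW (leq_maxr _ _)) yx /(agreeW (leq_maxr _ _)) yw e.
have := pM x; have := pM w; have := pM (T x) => h1 h2 h3.
apply: nP; rewrite ?(leq_trans h2) //; try lia.
rewrite addrC (zpowD (csK sR) (csKV sR)) /=.
apply: agree_trans (agreeW (leq_maxl _ _) yw); rewrite -e agree_sym.
by apply: lP; [apply: agreeW yx; exact: leq_maxr|lia].
Qed.

(** [eta k] is chosen after [p k] so as to separate its times, and stage [k + 1] moves the
    approximate embedding only beyond depth [eta k]; the separation thus passes to the limit. *)
Lemma stage_sequence : exists (p : nat -> (nat -> bool) -> int) (eta : nat -> nat),
  forall k, [/\ stage k (p k), separates (p k) (eta k), eta k < eta k.+1,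
    forall x, ~~ agree k xs x -> (p k.+1 (T x) - p k.+1 x = p k (T x) - p k x)%R &
    forall x, agree (eta k) (zR (p k.+1 x)) (zR (p k x))].
Proof.
pose good k (s : ((nat -> bool) -> int) * nat) := stage k s.1 /\ separates s.1 s.2.
have /choice[F FP] (ks : nat * (((nat -> bool) -> int) * nat)) : exists s',
    good ks.1 ks.2 -> [/\ good ks.1.+1 s', ks.2.2 < s'.2,
    forall x, ~~ agree ks.1 xs x -> (s'.1 (T x) - s'.1 x = ks.2.1 (T x) - ks.2.1 x)%R &
    forall x, agree ks.2.2 (zR (s'.1 x)) (zR (ks.2.1 x))].
  have [[st _]|ng] := pselect (good ks.1 ks.2); last by exists ks.2.
  have [p' [st' inc p'_near]] := stage_extend sT sR z ks.2.2 st.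
  have [eta' lt sep] := separates_ex ks.2.2 (stage_lc st').
  by exists (p', eta') => _; split.
have [p0 st0] := stage0 sT xs.
have [eta0 _ sep0] := separates_ex 0 (stage_lc st0).
pose P k := nat_rect (fun=> (((nat -> bool) -> int) * nat)%type) (p0, eta0)
  (fun k s => F (k, s)) k.
have gP k : good k (P k) by elim: k => // k /(FP (k, P k))[].
exists (fun k => (P k).1), (fun k => (P k).2) => k.
by have [? ? ? ?] := FP (k, P k) (gP k); have [? ?] := gP k; split.
Qed.

Lemma cantor_embedding :
  exists (phi : (nat -> bool) -> nat -> bool) (n : (nat -> bool) -> nat),
    [/\ unif_cont phi, injective phi &
      forall x, [/\ 0 < n x, phi (T x) = iter (n x) R (phi x) &
        forall m w, 0 < m < n x -> iter m R (phi x) <> phi w]].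
Proof.
have [p [eta pP]] := stage_sequence.
have st k : stage k (p k) by case: (pP k).
have sep k : separates (p k) (eta k) by case: (pP k).
have eta_lt k : eta k < eta k.+1 by case: (pP k).
have eta_ge k : k <= eta k by elim: k => // k IH; exact: leq_ltn_trans (eta_lt k).
have p_near k j x : agree (eta k) (zR (p (k + j)%N x)) (zR (p k x)).
  elim: j => [|j IH]; first by rewrite addn0 agree_refl.
  apply: agree_trans IH; rewrite addnS.
  have [_ _ _ _ /(_ x)] := pP (k + j); apply: agreeW.
  by elim: j => [|j IH]; rewrite ?addn0 // addnS ltnW // (leq_ltn_trans IH).
have inc k j x : ~~ agree k xs x ->
    (p (k + j)%N (T x) - p (k + j)%N x = p k (T x) - p k x)%R.
  move=> nU; elim: j => [|j <-]; first by rewrite addn0.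
  rewrite addnS; have [_ _ _ -> //] := pP (k + j).
  by apply: contra nU; apply: agreeW; exact: leq_addr.
(* Coordinate [i] is read at stage [i + 1], after which it is frozen since [eta i.+1 > i]. *)
pose phi x i := zR (p i.+1 x) i.
have phiP k x : agree (eta k) (phi x) (zR (p k x)).
  apply/agreeP => i ik; rewrite /phi.
  have /agreeP <- // := p_near k i.+1 x; rewrite addnC.
  by have /agreeP -> // := p_near i.+1 k x; exact: eta_ge.
have returns x : exists n, [/\ 0 < n, phi (T x) = iter n R (phi x) &
    forall m w, 0 < m < n -> iter m R (phi x) <> phi w].
  have [->|/neq_disagree[k]] := pselect (x = xs).
    exists 1; split => //; last by move=> [|m].
    have phi_xs : phi xs = z.
      by apply: agree_eq => k; rewrite (agreeW (eta_ge k)) // -[z in agree _ _ z]/(zR 0)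
        -(stage_top (st k)).
    rewrite phi_xs; apply: agree_eq => k; apply: agreeW (eta_ge k) _.
    by have := phiP k (T xs); rewrite (stage_bot (st k)).
  rewrite agree_sym => nU; have lt := stage_lt (st k) nU.
  pose n := `|(p k (T x) - p k x)%R|%N.
  have nE : (p k (T x) - p k x = n%:Z)%R by rewrite /n; lia.
  exists n; split; first by lia.
    apply: agree_eq => i; have [l lP] := unif_cont_iter n (cs_cont sR) i.
    set j := maxn i l.
    have pj : p (k + j)%N (T x) = (n%:Z + p (k + j)%N x)%R.
      by have := inc k j x nU; lia.
    have jeta : j <= eta (k + j) by apply: leq_trans (eta_ge _); exact: leq_addl.
    apply: (@agree_trans _ (zR (p (k + j)%N (T x)))).
      apply: agreeW (phiP _ _); apply: leq_trans jeta; exact: leq_maxl.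
    rewrite pj (zpowD (csK sR) (csKV sR)) agree_sym; apply: lP.
    apply: agreeW (phiP _ _); apply: leq_trans jeta; exact: leq_maxr.
  (* By [sep], such an early return would put [p k w] strictly between [p k x] and [p k (T x)],
     against [stage_gap]. *)
  move=> m w /andP[m0 mn] e.
  have := sep k x w _ _ m _ (phiP k x) (phiP k w) e; rewrite -/n => /(_ (ltnW mn)).
  have := stage_gap (st k) w nU; lia.
have [n nP] := choice returns.
exists phi, n; split => //.
- move=> k; have [m pm] := stage_lc (st k); exists m => x y /pm pxy.
  apply: (agreeW (eta_ge k)); apply: agree_trans (phiP k x) _.
  by rewrite pxy agree_sym.
- move=> x w e; apply: agree_eq => k; apply: (stage_sep (st k)).
  by have := sep k x w _ _ 0 (leq0n _) (phiP k x) (phiP k w) e; rewrite addr0.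
Qed.

End Limit.

(** * Transfer to topological systems *)

Local Open Scope classical_set_scope.

(** Each point outside the interior of [A] disagrees with [x] at some depth, as do its neighbours;
    compactness of that closed set yields one depth for all. *)
Lemma nbhs_cantorP (x : cantor_space) (A : set cantor_space) :
  nbhs x A <-> exists n, forall y, agree n x y -> A y.
Proof.
have cyl n (y : cantor_space) : \forall y' \near y, agree n y y'.
  elim: n => [|n IH]; first by near=> y'; apply/agreeP.
  have yn : \forall y' \near y, y' n = y n.
    have := @proj_continuous nat (fun=> bool) n y.
    by move=> /(_ [set b | b = y n]); apply; exact: discrete_set1.
  near=> y'; have /agreeP h : agree n y y' by near: y'.
  apply/agreeP => i; rewrite ltnS leq_eqVlt => /predU1P[->|]; last exact: h.
  by apply: esym; near: y'.
split=> [Ax|[n nA]]; last by apply: filterS (cyl n x); exact: nA.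
have [] := iffLR (@compact_near_coveringP cantor_space (~` A°)) _ nat \oo
  (fun n y => ~~ agree n x y) _.
- apply: (subclosed_compact _ cantor_space_compact) => //.
  exact/open_closedC/open_interior.
- move=> y nAy; have [n nxy] : exists n, ~~ agree n x y.
    by apply: neq_disagree => xy; apply: nAy; rewrite -xy.
  near=> y' i.
  have yy' : agree n y y' by near: y'; exact: cyl.
  have ni : n <= i by near: i; exact: nbhs_infty_ge.
  apply: contra nxy => /(agreeW ni) xy'.
  by apply: (@agree_trans _ y'); rewrite // agree_sym.
- move=> N _ NA; exists N => y xy; apply: (@interior_subset cantor_space A y); apply: contrapT.
  by move=> /(NA N (leqnn N)); rewrite xy.
Unshelve. all: by end_near. Qed.

Lemma agree_near n (x : cantor_space) : \forall y \near x, agree n x y.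
Proof. by apply/nbhs_cantorP; exists n. Qed.

Lemma unif_cont_continuous f : unif_cont f -> continuous (f : cantor_space -> cantor_space).
Proof.
move=> fc x A /nbhs_cantorP[n nA]; have [m mf] := fc n.
by apply/nbhs_cantorP; exists m => y /mf/nA.
Qed.

Lemma continuous_unif_cont (f : cantor_space -> cantor_space) :
  continuous f -> unif_cont f.
Proof.
move=> fc n.
have [] := iffLR (@compact_near_coveringP cantor_space _) cantor_space_compact nat \oo
  (fun m x => forall y, agree m x y -> agree n (f x) (f y)) _.
- move=> x _; have /nbhs_cantorP[m hm] := fc x _ (agree_near n (f x)).
  near=> x' i => y xy.
  have xx' : agree m x x' by near: x'; exact: agree_near.
  have mi : m <= i by near: i; exact: nbhs_infty_ge.
  apply: (@agree_trans _ (f x)); first by rewrite agree_sym; exact: hm.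
  by apply: hm; apply: agree_trans xx' _; apply: agreeW xy.
- by move=> N _ hN; exists N => x y; apply: (hN N (leqnn N)).
Unshelve. all: by end_near. Qed.

Lemma cantor_homeo (R : realType) (X : pseudoMetricType R) : cantor_set X ->
  exists (h : cantor_space -> X) (k : X -> cantor_space),
    [/\ cancel h k, cancel k h, continuous h & continuous k].
Proof.
move=> [[x0 _] cX].
pose PX := HB.pack_for (pseudoPMetricType R) X (isPointed.Build X x0).
have [f [fc fcl]] := @homeomorphism_cantor_like R PX cX.
exists f, (f^-1)%FUN; split => //.
- by move=> x; apply: funK; rewrite inE.
- by move=> x; apply: invK; rewrite inE.
(* The inverse is continuous because [f] is a closed map. *)
- apply/continuous_closedP => A Acl.
  suff -> : (f^-1)%FUN @^-1` A = f @` A by exact: fcl.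
  apply/seteqP; split => [x Ax|_ [y Ay <-]] /=.
    by exists ((f^-1)%FUN x) => //; apply: invK; rewrite inE.
  by rewrite funK ?inE.
Qed.

Lemma minimal_cantor_system_code (R : realType) (X : pseudoMetricType R) (T : X -> X) :
  minimal_cantor_system T ->
  exists (h : cantor_space -> X) (k : X -> cantor_space) T',
    [/\ cancel h k, cancel k h, continuous h, continuous k &
        cantor_system (k \o T \o h) T'].
Proof.
move=> [cX [Tinv [[TK TinvK Tc Tinvc] Tmin]]].
have [h [k [hK kK hc kc]]] := cantor_homeo cX.
exists h, k, (k \o Tinv \o h); split => //; set S := k \o T \o h.
set S' := k \o Tinv \o h.
have compc (f : X -> X) : continuous f -> unif_cont (k \o f \o h).
  move=> fc; apply: continuous_unif_cont => x.
  by apply: continuous_comp (kc _); apply: continuous_comp (fc _); exact: hc.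
have Sc := compc _ Tc; have S'c := compc _ Tinvc.
have iterE (f : X -> X) n x : iter n (k \o f \o h) (k x) = k (iter n f x).
  by elim: n => //= n ->; rewrite kK.
split => //; try by move=> x; rewrite /S /S' /= kK ?TK ?TinvK hK.
move=> n x.
(* Each [y] has a visit time to the cylinder of [x] that also serves nearby points; compactness
   bounds these times. *)
have [] := iffLR (@compact_near_coveringP cantor_space _) cantor_space_compact nat \oo
  (fun N y => exists j : int, `|j|%N <= N /\ agree n x (zpow S S' j y)) _.
- move=> y _; have : closure (Defs.orbit T Tinv (h y)) (h x) by rewrite Tmin.
  have kn : nbhs (h x) [set w | agree n x (k w)].
    by have := kc (h x) [set w | agree n x w]; rewrite hK; apply; exact: agree_near.
  move=> /(_ _ kn)[w [[i iw] xw]].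
  have [j jw] : exists j, zpow S S' j y = k w.
    rewrite -[y]hK; case: iw => ->; first by exists (Posz i); exact: iterE.
    by case: i => [|i]; [exists (Posz 0)|exists (Negz i); exact: iterE].
  have xj : agree n x (zpow S S' j y) by rewrite jw.
  have [m hm] : exists m, forall y', agree m y y' ->
      agree n (zpow S S' j y) (zpow S S' j y').
    by case: (j) => i'; have [m hm] := unif_cont_iter i' Sc n;
      have [m' hm'] := unif_cont_iter i'.+1 S'c n; [exists m|exists m'] => y';
      [exact: hm|exact: hm'].
  near=> y' N.
  have yy' : agree m y y' by near: y'; exact: agree_near.
  have jN : `|j|%N <= N by near: N; exact: nbhs_infty_ge.
  by exists j; split; last exact: agree_trans xj (hm _ yy').
- by move=> N _ hN; exists N => y; apply: (hN N (leqnn N)).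
Unshelve. all: by end_near. Qed.

(** * The range of an embedding as a Poincaré section *)

Section RangeOfFirstReturns.
Context (X Y : topologicalType) (T : X -> X) (R : Y -> Y) (phi : X -> Y).
Context (n : X -> nat) (x0 : X).
Hypotheses (cX : compact [set: X]) (hY : hausdorff_space Y).
Hypotheses (phic : continuous phi) (phi_inj : injective phi).
Hypothesis n_gt0 : forall x, 0 < n x.
Hypothesis phiT : forall x, phi (T x) = iter (n x) R (phi x).
Hypothesis phi_first : forall x m w, 0 < m < n x -> iter m R (phi x) <> phi w.

Let psi (y : Y) : X := xget x0 [set x | phi x = y].

Let phiK : cancel phi psi.
Proof.
move=> x; apply: phi_inj.
by apply: (@xgetPex _ x0 [set x' | phi x' = phi x]); exists x.
Qed.

Lemma first_return_range x : first_return R (range phi) (phi x) = phi (T x).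
Proof.
rewrite /first_return phiT; congr (iter _ R _); rewrite /return_time.
apply: xget_unique.
  split=> //; split; first by exists (T x).
  by move=> m mn [w _ /esym]; exact: phi_first.
move=> m [m0 [[w _ wm] mmin]]; apply/eqP; rewrite eqn_leq; apply/andP; split.
  rewrite leqNgt; apply/negP => lt; apply: (mmin (n x)); first by rewrite n_gt0.
  by exists (T x).
rewrite leqNgt; apply/negP => lt.
by apply: (@phi_first x m w); rewrite ?m0 // wm.
Qed.

(** [K] is compact, hence closed, and avoids [phi x] by injectivity, so its complement is the
    required neighbourhood. This serves for [psi], for the first return and for its inverse. *)
Lemma within_range_continuous (Z : topologicalType) (f : X -> Z) (g : Y -> Z) :
  continuous f -> (forall x, g (phi x) = f x) -> {within range phi, continuous g}.
Proof.
move=> fc gE; apply/subspace_continuousP => _ [x _ <-] W.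
move=> gW; have Wx : nbhs x (f @^-1` W) by apply: fc; rewrite -gE.
rewrite /nbhs /= /within /=.
pose K := phi @` (~` (f @^-1` W)°).
have Kcl : closed K.
  apply: (compact_closed hY); apply: continuous_compact; first exact: continuous_subspaceT.
  apply: (subclosed_compact _ cX) => //.
  exact/open_closedC/open_interior.
have : nbhs (phi x) (~` K).
  apply: open_nbhs_nbhs; split; first exact: closed_openC.
  by move=> [x' nx /phi_inj xx']; apply: nx; rewrite xx'.
apply: filterS => y nK [x' _ x'E]; move: nK; rewrite -x'E => nK.
change (W (g (phi x'))); rewrite gE; apply: (@interior_subset _ (f @^-1` W)); apply: contrapT => nx'.
by apply: nK; exists x'.
Qed.

Lemma conjugate_section (Tinv : X -> X) : is_homeo T Tinv ->
  poincare_section R (range phi) /\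
  conjugate_to_subsystem T (range phi) (first_return R (range phi)).
Proof.
move=> [TK TinvK Tc Tinvc].
have fr := first_return_range.
have phi_compc (f : X -> X) : continuous f -> continuous (phi \o f).
  by move=> fc x; apply: continuous_comp; [exact: fc|exact: phic].
split; last first.
  exists phi, psi; split; last by move=> x; rewrite fr.
  split => //.
  - by move=> y /set_mem[x _ <-]; rewrite phiK.
  - by apply: (@within_range_continuous _ id) => x; [exact: cvg_id|exact: phiK].
split.
  split.
  - by exists (phi x0), x0.
  - by apply: (compact_closed hY); apply: continuous_compact => //; exact: continuous_subspaceT.
  - by move=> _ [x _ <-]; exists (n x); split=> //; exists (T x).
  - split.
    + by move=> _ [x _ <-]; rewrite fr; exists (T x).
    + move=> _ _ /set_mem[x _ <-] /set_mem[w _ <-]; rewrite !fr => /phi_inj.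
      by move/(can_inj TK) => ->.
    + by move=> _ [x _ <-]; exists (phi (Tinv x)); [exists (Tinv x)|rewrite fr TinvK].
  - exact: (within_range_continuous (phi_compc _ Tc)).
exists (phi \o Tinv \o psi); split.
- by move=> _ /set_mem[x _ <-]; rewrite fr /= phiK TK.
- by move=> _ /set_mem[x _ <-]; rewrite /= phiK fr TinvK.
- by move=> _ [x _ <-]; exists (Tinv x); rewrite //= phiK.
- by apply: (within_range_continuous (phi_compc _ Tinvc)) => x; rewrite /= phiK.
Qed.

End RangeOfFirstReturns.

Theorem mainTheorem5 (R1 : realType) (X : pseudoMetricType R1) (T : X -> X)
  (R2 : realType) (Y : pseudoMetricType R2) (R : Y -> Y) :
  minimal_cantor_system T -> minimal_cantor_system R ->
  exists C : set Y, poincare_section R C /\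
    conjugate_to_subsystem T C (first_return R C).
Proof.
move=> mT mR.
have [hX [kX [T' [hXK kXK hXc kXc sT]]]] := minimal_cantor_system_code mT.
have [hY [kY [R' [hYK kYK hYc kYc sR]]]] := minimal_cantor_system_code mR.
have [[[x0 _] [_ cX _ _]] [Tinv [homT _]]] := mT.
have [[_ [_ _ hausY _]] _] := mR.
(* Any sequences serve as [xs] and [z]; [kX x0] is taken for both. *)
have [phi [n [phic phi_inj phiP]]] := cantor_embedding sT sR (kX x0) (kX x0).
have iterE m y : hY (iter m (kY \o R \o hY) y) = iter m R (hY y).
  by elim: m => //= m <-; rewrite kYK.
exists (range (hY \o phi \o kX)).
apply: (@conjugate_section _ _ T R _ (n \o kX) x0 cX hausY _ _ _ _ _ Tinv) => //.
- move=> x; apply: continuous_comp; first exact: kXc.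
  by apply: continuous_comp; [exact: unif_cont_continuous|exact: hYc].
- by move=> x w /= /(can_inj hYK)/phi_inj/(can_inj kXK).
- by move=> x /=; have [] := phiP (kX x).
- by move=> x /=; have [_ + _] := phiP (kX x); rewrite /= kXK => ->.
- move=> x m w /= mn; rewrite -iterE => /(can_inj hYK).
  by have [_ _] := phiP (kX x); apply.
Qed.
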